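(* Let $G$ be a stepwise transmission irregular (STI) graph of order $n$. Then $$\frac{3n^2-4n+1}{4} \le W(G) \le \frac{n^3-n^2-n+17}{8}.$$ Moreover, the left equality holds if and only if $G\cong K_{\frac{n-1}{2},\frac{n+1}{2}}$, and, for $n\ge 5$, the right equality holds if and only if $G\cong G_n$.
   Context: All graphs are finite, simple and connected. The distance $d_G(u,v)$ is the number of edges on a shortest $u,v$-path. The transmission of a vertex $v$ is $\mathrm{Tr}_G(v)=\sum_{u\in V(G)} d_G(u,v)$. A connected graph $G$ is stepwise transmission irregular (STI) if $|\mathrm{Tr}_G(u)-\mathrm{Tr}_G(v)|=1$ for every edge $uv\in E(G)$. (It is known that every STI graph is bipartite and of odd order.) The Wiener index of $G$ is $W(G)=\sum_{\{u,v\}\subseteq V(G)}d_G(u,v)$, the sum of distances over all unordered pairs of vertices. $K_{p,q}$ denotes the complete bipartite graph with parts of sizes $p$ and $q$ ($K_{0,1}$ is the one-vertex graph). For $n\ge 5$, the graph $G_n$ (hatted cycle) has vertex set $\{v_1,\ldots,v_n\}$, where $v_1,\ldots,v_{n-1}$ (in this cyclic order) induce a cycle of length $n-1$, and $v_n$ is adjacent exactly to $v_1$ and $v_3$. *)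

(* Defs.v *)
From mathcomp Require Import all_boot all_order all_algebra.
Set Implicit Arguments.
Unset Strict Implicit.
Unset Printing Implicit Defensive.
Import Order.TTheory GRing.Theory Num.Theory.

Section Graph.

Variables (T : finType) (e : rel T).

Definition simple_graph : Prop := symmetric e /\ irreflexive e.

(* The null graph is not connected. *)
Definition connected_graph : Prop :=
  0 < #|T| /\ forall u v : T, connect e u v.

Definition has_path_of_length (u v : T) (k : nat) : bool :=
  [exists p : k.-tuple T, [&& path e u p, uniq (u :: p) & last u p == v]].

(* A path has at most #|T| - 1 edges, so the first k below #|T| that is the
   length of some u,v-path is the distance; the value is #|T| if there is no
   u,v-path, which does not happen in a connected graph. *)
Definition dist (u v : T) : nat :=
  find (has_path_of_length u v) (iota 0 #|T|).

Definition transmission (v : T) : nat := \sum_(u : T) dist u v.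

Definition STI : Prop :=
  connected_graph /\
  forall u v : T, e u v ->
    (`| (transmission u)%:Z - (transmission v)%:Z | = 1)%R.

(* Each unordered pair of distinct vertices is counted once, in the order in
   which T enumerates its two elements. *)
Definition wiener : nat :=
  \sum_(u : T) \sum_(v : T | enum_rank u < enum_rank v) dist u v.

End Graph.

Definition graph_iso (T1 T2 : finType) (e1 : rel T1) (e2 : rel T2) : Prop :=
  exists f : T1 -> T2, bijective f /\ forall x y, e2 (f x) (f y) = e1 x y.

Definition complete_bipartite (p q : nat) : rel ('I_p + 'I_q)%type :=
  fun x y => match x, y with
             | inl _, inr _ | inr _, inl _ => true
             | _, _ => false
             end.

(* The vertex v_k is the ordinal k - 1: the cycle is 0, ..., n - 2, and the
   hat n - 1 is adjacent to 0 and 2. This is meant for 5 <= n. *)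
Definition hatted_cycle (n : nat) : rel 'I_n :=
  fun i j =>
    let arc (a b : nat) :=
      (a < n.-1) && (b == a.+1 %% n.-1) || (a == n.-1) && (b \in [:: 0; 2]) in
    arc i j || arc j i.

(* Main.v *)
(* Along an edge uv the transmissions differ by the numbers of vertices nearer
   to u and nearer to v, and by parity an STI graph is bipartite, so these two
   numbers are m and m + 1, where n = 2m + 1.

   Lower bound: vertices in the same part are at distance at least 2, those in
   different parts at distance at least 1, and the part sizes p + q = 2m + 1
   minimize p^2 + q^2 when they are m and m + 1.

   Upper bound, for m >= 2: the half-half balance of the edges forbids cut
   vertices, so every distance level of a vertex, except the level 0 and the
   last, has at least two elements, and Tr <= m(m + 1). Let v have the largest
   transmission M = m^2 + 1 + r. If r <= 0, summing Tr <= M suffices. If r > 0,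
   the levels 1, ..., r of v have exactly two elements and form two disjoint
   paths leaving v, whose inner vertices have degree 2. A vertex of degree 2 is
   never a local minimum of Tr, so Tr = M - k at level k <= r; Tr changes by at
   most 1 along the edges beyond. Summing, W <= m^3 + m^2 + m + 1 - r(m - r),
   which is at most m^3 + m^2 + 2 for 1 <= r <= m - 1. Equality leaves r = 1,
   excluded for m >= 3 by two neighbours of v with smaller transmission, and
   r = m - 1, where the levels of v determine the graph. *)
Require Import Defs.
From mathcomp Require Import all_boot all_order all_algebra.
From mathcomp Require Import zify ring.
Set Implicit Arguments.
Unset Strict Implicit.
Unset Printing Implicit Defensive.
Import Order.TTheory GRing.Theory Num.Theory.

(** * Coordinates on the hatted cycle *)

Section HattedCycle.

Variable k : nat.
Hypothesis k_gt1 : 1 < k.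

(** The modulus only matters at the edge that closes the cycle; this form splits off that edge. *)
Lemma hatted_cycleE (i j : 'I_k.*2.+1) :
  let arc (a b : nat) := [|| (a.+1 < k.*2) && (b == a.+1),
    (a.+1 == k.*2) && (b == 0) | (a == k.*2) && ((b == 0) || (b == 2))] in
  hatted_cycle i j = arc i j || arc j i.
Proof.
have aux (a b : nat) : a <= k.*2 -> (a < k.*2) && (b == a.+1 %% k.*2) =
    (a.+1 < k.*2) && (b == a.+1) || (a.+1 == k.*2) && (b == 0).
  rewrite leq_eqVlt => /predU1P[->|lt].
    by rewrite ltnn ltnNge leqnSn (gtn_eqF (ltnSn _)).
  rewrite lt; move: (lt); rewrite leq_eqVlt => /predU1P[<-|lt1].
    by rewrite modnn ltnn eqxx.
  by rewrite modn_small // lt1 (ltn_eqF lt1) orbF.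
have [ik jk] := (leq_ord i, leq_ord j).
by rewrite /hatted_cycle /= !aux // !inE -!orbA.
Qed.

(* Walking away from the antipode [k.+1] of the vertex 1, the vertex at
   distance [l] on the given side; the twins 1 and [k.*2] share the level [k]. *)
Definition hat_pos (l : nat) (side : bool) : nat :=
  if side then k.+1 - l
  else if l == k then k.*2 else if l == k.-1 then 0 else k.+1 + l.

Lemma hat_pos_lt l side : l <= k -> (0 < l) || side -> hat_pos l side < k.*2.+1.
Proof. by rewrite /hat_pos; case: side; [|case: eqP; [|case: eqP]]; lia. Qed.

Lemma hat_pos_inj l s l' s' : l <= k -> l' <= k -> (0 < l) || s -> (0 < l') || s' ->
  hat_pos l s = hat_pos l' s' -> l = l' /\ s = s'.
Proof.
rewrite /hat_pos => lk l'k; case: s; case: s' => /=; rewrite ?orbF => vl vl'.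
- by move=> eq_pos; split=> //; lia.
- by (case: (l' =P k) => ?; [|case: (l' =P k.-1) => ?]); lia.
- by (case: (l =P k) => ?; [|case: (l =P k.-1) => ?]); lia.
- by move=> eq_pos; split=> //; move: eq_pos;
     (case: (l =P k) => ?; [|case: (l =P k.-1) => ?]);
    (case: (l' =P k) => ?; [|case: (l' =P k.-1) => ?]); lia.
Qed.

(** An edge from level [l] up to level [l']. The two sides are disjoint paths except at the root,
    joined to both, and at the last level, whose two vertices are joined to both vertices of level
    [k.-1]. *)
Definition hat_adj (l : nat) (s : bool) (l' : nat) (s' : bool) :=
  (l' == l.+1) && [|| l == 0, l' == k | s == s'].

Lemma hat_pos_adj l s l' s' (i j : 'I_k.*2.+1) :
  l <= k -> l' <= k -> (0 < l) || s -> (0 < l') || s' ->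
  i = hat_pos l s :> nat -> j = hat_pos l' s' :> nat ->
  hatted_cycle i j = hat_adj l s l' s' || hat_adj l' s' l s.
Proof.
rewrite hatted_cycleE /hat_pos /hat_adj => lk l'k vl vl' -> ->.
move: vl vl'; case: s; case: s' => /=; rewrite ?orbF ?orbT ?andbT => vl vl'.
- by apply/idP/idP; lia.
- by (case: (l' =P k) => ?; [|case: (l' =P k.-1) => ?]); apply/idP/idP; lia.
- by (case: (l =P k) => ?; [|case: (l =P k.-1) => ?]); apply/idP/idP; lia.
- by (case: (l =P k) => ?; [|case: (l =P k.-1) => ?]);
    (case: (l' =P k) => ?; [|case: (l' =P k.-1) => ?]); apply/idP/idP; lia.
Qed.

(** The distance from the vertex [k.+1], with the vertex 0 counted as position [k.*2] of the cycle;
    the sum of truncated differences is an absolute value. *)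
Definition hat_dist (i : nat) : nat :=
  if i == 0 then k.-1 else if i == k.*2 then k else (i - k.+1) + (k.+1 - i).

Lemma hat_dist_step (i j : 'I_k.*2.+1) :
  hatted_cycle i j -> hat_dist j <= (hat_dist i).+1.
Proof.
rewrite hatted_cycleE /hat_dist; have [ik jk] := (leq_ord i, leq_ord j).
move: (nat_of_ord i) (nat_of_ord j) ik jk => a b ak bk /=.
case: (a =P 0) => ?; [|case: (a =P k.*2) => ?];
by case: (b =P 0) => ?; [|case: (b =P k.*2) => ?]; lia.
Qed.

Lemma sum_hat_dist : \sum_(i < k.*2.+1) hat_dist i = k * k.+1.
Proof.
(* Twice the sum over [t] positions below [k.+1] and [s] positions from [k.+1] upwards: two
   arithmetic progressions. The vertices 0 and [k.*2] are added afterwards. *)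
have mid t s : t <= k -> s <= k.-1 -> 2 * \sum_(k.+1 - t <= i < k.+1 + s) hat_dist i
    = t * t.+1 + s * s.-1.
  move=> tk; elim: s => [|s IHs] sk.
    elim: t tk => [|t IHt] tk; first by rewrite subn0 addn0 big_geq.
    rewrite subSS big_ltn; last by lia.
    rewrite mulnDr -[X in \sum_(X <= i < _) _](_ : k.+1 - t = _); last by lia.
    have -> : hat_dist (k - t) = t.+1.
      by rewrite /hat_dist; case: (_ =P 0) => ?; [|case: (_ =P k.*2) => ?]; lia.
    by rewrite IHt 1?ltnW //; lia.
  rewrite addnS big_nat_recr /=; last by lia.
  rewrite mulnDr IHs; last by lia.
  have -> : hat_dist (k.+1 + s) = s.
    by rewrite /hat_dist; case: (_ =P 0) => ?; [|case: (_ =P k.*2) => ?]; lia.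
  by nia.
rewrite big_ord_recr /= -(big_mkord xpredT) big_ltn; last by lia.
have -> : k.*2 = k.+1 + k.-1 by lia.
have := mid k k.-1 (leqnn _) (leqnn _); rewrite subSnn.
set S := \sum_(_ <= i < _) _.
have -> : hat_dist (k.+1 + k.-1) = k.
  by rewrite /hat_dist; case: (_ =P 0) => ?; [|case: (_ =P k.*2) => ?]; lia.
by have -> : hat_dist 0 = k.-1 by []; nia.
Qed.

End HattedCycle.

(** * Distances in connected graphs *)

Section Graph.

Variables (T : finType) (e : rel T).
Hypotheses (e_sym : symmetric e) (e_conn : forall u v, connect e u v).
Local Notation d := (dist e).

Lemma uniq_path_size u (p : seq T) : uniq (u :: p) -> size p < #|T|.
Proof. by move=> /card_uniqP => Hu; have := max_card (mem (u :: p)); rewrite Hu. Qed.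

Lemma dist_le_size u p : path e u p -> d u (last u p) <= size p.
Proof.
move=> /shortenP[p' ep' up' sub].
have up : uniq p' by case/andP: up'.
apply: leq_trans (uniq_leq_size up sub).
rewrite leqNgt; apply/negP => lt.
have ltn := uniq_path_size up'.
(* The length of the shortened path lies before the index where [find] stopped, so it was rejected,
   although this path witnesses it. *)
have := before_find 0 lt; rewrite nth_iota // add0n => /negbT/existsPn/(_ (in_tuple p')).
by rewrite ep' up' eqxx.
Qed.

Lemma has_dist u v : has (has_path_of_length e u v) (iota 0 #|T|).
Proof.
have /connectP[p ep ->] := e_conn u v.
case/shortenP: ep => p' ep' up' _.
apply/hasP; exists (size p'); first by rewrite mem_iota add0n (uniq_path_size up').
by apply/existsP; exists (in_tuple p'); rewrite ep' up' /= eqxx.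
Qed.

Lemma dist_lt_card u v : d u v < #|T|.
Proof. by rewrite -[X in _ < X](size_iota 0) -has_find has_dist. Qed.

Lemma dist_path u v :
  exists p, [/\ path e u p, last u p = v & size p = d u v].
Proof.
have := nth_find 0 (has_dist u v).
rewrite -/(d u v) nth_iota ?add0n ?dist_lt_card //.
by case/existsP=> p /and3P[ep _ /eqP lp]; exists p; rewrite size_tuple.
Qed.

Lemma dist_eq0 u v : (d u v == 0) = (u == v).
Proof.
apply/eqP/eqP => [d0|->].
  by have [p [_ lp]] := dist_path u v; rewrite d0 => /size0nil p0; rewrite -lp p0.
by apply/eqP; rewrite -leqn0; have := @dist_le_size v [::] isT.
Qed.

Lemma dist_xx u : d u u = 0.
Proof. by apply/eqP; rewrite dist_eq0. Qed.

Lemma dist_triangle u v w : d u w <= d u v + d v w.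
Proof.
have [p [ep lp <-]] := dist_path u v; have [q [eq lq <-]] := dist_path v w.
rewrite -size_cat -lq -lp -last_cat; apply: dist_le_size.
by rewrite cat_path ep lp.
Qed.

Lemma dist_sym u v : d u v = d v u.
Proof.
have le x y : d x y <= d y x.
  have [p [ep <- <-]] := dist_path y x.
  have := @dist_le_size (last y p) (rev (belast y p)).
  have -> : last (last y p) (rev (belast y p)) = y.
    by case: p {ep} => //= z p; rewrite rev_cons last_rcons.
  rewrite size_rev size_belast; apply.
  by rewrite rev_path (eq_path (e' := e)) // => a b; rewrite /= e_sym.
by apply/eqP; rewrite eqn_leq !le.
Qed.

Lemma dist_step u x y : e x y -> d u y <= (d u x).+1.
Proof.
move=> exy; apply: leq_trans (dist_triangle u x y) _.
by rewrite -addn1 leq_add2l; have := @dist_le_size x [:: y]; rewrite /= exy; apply.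
Qed.

Lemma dist_pred u y k : d u y = k.+1 -> exists2 x, e x y & d u x = k.
Proof.
have [p [ep lp sp]] := dist_path u y => dk.
case/lastP: p => [|p z] in ep lp sp *; first by rewrite -sp in dk.
move: ep lp sp; rewrite rcons_path last_rcons size_rcons => /andP[ep ez] zy.
subst z; rewrite dk => -[spk]; exists (last u p) => //.
apply/eqP; rewrite eqn_leq -{1}spk dist_le_size //=.
by have := dist_step u ez; rewrite dk.
Qed.

Lemma dist1 x y : irreflexive e -> (d x y == 1) = e x y.
Proof.
move=> irr; apply/eqP/idP => [/dist_pred[z ez /eqP]|exy].
  by rewrite dist_eq0 => /eqP ->.
apply/eqP; rewrite eqn_leq; have := dist_step x exy; rewrite dist_xx => -> /=.
by rewrite lt0n dist_eq0; apply: contraTneq exy => ->; rewrite irr.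
Qed.

Lemma dist_between u y k : k <= d u y -> exists2 x, d u x = k & d x y = d u y - k.
Proof.
move=> le; have [j dj] : exists j, d u y = k + j by exists (d u y - k); lia.
elim: j y {le} dj => [|j IH] y dj.
  by exists y; rewrite ?dist_xx; lia.
have [x exy dx] := @dist_pred u y (k + j) ltac:(lia).
have [z dz dzx] := IH _ dx; exists z => //.
have := dist_step z exy; have := dist_triangle u z y; lia.
Qed.

Lemma wiener_transmission : (wiener e).*2 = \sum_u transmission e u.
Proof.
rewrite /wiener /transmission -addnn.
have -> : \sum_u \sum_v d v u = \sum_u \sum_v d u v.
  by apply: eq_bigr => u _; apply: eq_bigr => v _; apply: dist_sym.
have split_rank u : \sum_v d u v = \sum_(v | enum_rank u < enum_rank v) d u v
    + \sum_(v | enum_rank v < enum_rank u) d u v.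
  rewrite (bigID (fun v => enum_rank u < enum_rank v)) /=; congr (_ + _).
  rewrite (bigID (fun v => enum_rank v < enum_rank u)) /= [X in _ + X]big1 ?addn0.
    by apply: eq_bigl => v; lia.
  move=> v le; suff -> : u = v by rewrite dist_xx.
  by apply: enum_rank_inj; apply: val_inj => /=; lia.
under [RHS]eq_bigr do rewrite split_rank.
rewrite big_split /=; congr (_ + _).
rewrite (exchange_big_dep xpredT) //=.
by apply: eq_bigr => u _; apply: eq_bigr => v _; apply: dist_sym.
Qed.

(** * Transmissions and balanced edges *)

Hypothesis T_gt0 : 0 < #|T|.
Hypothesis e_irr : irreflexive e.
Local Notation tr := (transmission e).
Hypothesis tr_step : forall u v, e u v -> tr u = (tr v).+1 \/ tr v = (tr u).+1.
Local Notation m := #|T|./2.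

(** Every edge flips the parity of [tr], so this parity is a proper 2-colouring and the graph is
    bipartite. *)
Lemma dist_odd u x : odd (d u x) = odd (tr u) (+) odd (tr x).
Proof.
have [k dk] : exists k, d u x = k by exists (d u x).
rewrite dk; elim: k x dk => [|k IH] x dk.
  by move/eqP: dk; rewrite dist_eq0 => /eqP ->; rewrite addbb.
have [y eyx dy] := dist_pred dk; rewrite oddS (IH y dy).
by case: (tr_step eyx) => ->; rewrite oddS; case: odd; case: odd.
Qed.

Lemma dist_edge u x y : e x y -> d u y = (d u x).+1 \/ d u x = (d u y).+1.
Proof.
move=> exy; have eyx : e y x by rewrite e_sym.
have : d u y != d u x.
  suff: odd (d u y) != odd (d u x) by apply: contraNneq => ->.
  by rewrite !dist_odd; case: (tr_step exy) => -> /=; case: odd; case: odd.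
have := dist_step u exy; have := dist_step u eyx.
by move: (d u x) (d u y) => a b; lia.
Qed.

Definition nearer x y := [set w | d w x < d w y].

Lemma card_nearer x y : e x y -> #|nearer x y| + #|nearer y x| = #|T|.
Proof.
move=> exy; rewrite -cardsUI -[RHS]cardsT -[RHS]addn0; congr (_ + _).
  by apply: eq_card => w; rewrite !inE; case: (dist_edge w exy); lia.
by apply/eqP; rewrite cards_eq0; apply/eqP/setP => w; rewrite !inE; lia.
Qed.

(** By bipartiteness, each vertex contributes exactly 1 to the transmission difference, with a sign
    given by the nearer end. *)
Lemma transmission_nearer x y : e x y -> tr y + #|nearer y x| = tr x + #|nearer x y|.
Proof.
move=> exy; rewrite -!sum1dep_card [X in _ + X]big_mkcond [X in _ = _ + X]big_mkcond.
rewrite -!big_split /=; apply: eq_bigr => w _.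
by case: (dist_edge w exy) => ->; do 2 case: ifP; lia.
Qed.

Lemma connected_ex_edge : 1 < #|T| -> exists x y, e x y.
Proof.
case/card_gt1P=> x [y [_ _ /negbTE nxy]].
move: (dist_eq0 x y); rewrite nxy; case dxy: (d x y) => [//|k] _.
by have [z ezy _] := dist_pred dxy; exists z, y.
Qed.

(** For an edge, the two [nearer] sets partition the vertices and their sizes differ by 1. *)
Lemma card_odd : #|T| = m.*2.+1.
Proof.
suff: odd #|T| by lia.
have [/connected_ex_edge[x [y exy]]|le1] := ltnP 1 #|T|.
  have := card_nearer exy; have := transmission_nearer exy.
  by case: (tr_step exy) => ->; lia.
by have -> : #|T| = 1 by lia.
Qed.

Lemma card_nearer_step x y : e x y -> #|nearer x y| = m + (tr x < tr y).
Proof.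
move=> exy; have := card_nearer exy; have := transmission_nearer exy.
by have := card_odd; case: (tr_step exy) => ->; lia.
Qed.

(** * Absence of cut vertices *)

Lemma dist_cut (c : T) (side : T -> bool) x y :
  (forall z w, z != c -> w != c -> e z w -> side z = side w) ->
  x != c -> y != c -> side x != side y -> d y c + d c x <= d y x.
Proof.
move=> side_e; have [k dk] : exists k, d y x = k by exists (d y x).
rewrite dk; elim: k x dk => [|k IH] x dk xc yc sxy.
  by move/eqP: dk sxy; rewrite dist_eq0 => /eqP ->; rewrite eqxx.
have [z ezx dz] := dist_pred dk.
have := dist_step c ezx; have [zc|zc] := eqVneq z c.
  by rewrite zc dist_xx -zc dz; lia.
by have := IH z dz zc yc; rewrite (side_e z x zc xc ezx); move=> /(_ sxy); lia.
Qed.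

(** Suppose [c] separates the graph and [S b] is a side with at least m vertices. For a neighbour
    [u] of [c] on the other side, [c] and all of [S b] are nearer to [c] than to [u]; as
    [nearer c u] has at most m + 1 elements, it consists of just these. One edge further,
    [nearer u w] contains [u] as well and has at least m + 2 elements, which is too many. *)
Lemma no_cut_vertex (c : T) (side : T -> bool) x0 y0 : 1 < m ->
  (forall z w, z != c -> w != c -> e z w -> side z = side w) ->
  x0 != c -> y0 != c -> side x0 = side y0.
Proof.
move=> m1 side_e x0c y0c; apply/eqP; apply: contraT => nxy.
pose S b := [set z | (z != c) && (side z == b)].
have cardS : #|S true| + #|S false| = m.*2.
  have : #|[set~ c]| = m.*2 by rewrite cardsC1; have := card_odd; lia.
  rewrite -(cardsID [set z | side z] [set~ c]) => <-.
  by congr (_ + _); apply: eq_card => z; rewrite !inE; case: (side z); rewrite ?andbT ?andbF.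
have [b Sb] : exists b, m <= #|S b|.
  by have [?|?] := leqP m #|S true|; [exists true | exists false; lia].
have [x xc sx] : exists2 x, x != c & side x = ~~ b.
  have [sx0|sx0] := eqVneq (side x0) b; [exists y0 | exists x0] => //.
    by move: nxy; rewrite sx0; case: (b); case: (side y0).
  by move: sx0; case: (b); case: (side x0).
have [u du dux] : exists2 u, d c u = 1 & d u x = d c x - 1.
  by apply: dist_between => //; rewrite lt0n dist_eq0 // eq_sym.
have cx_gt0 : 0 < d c x by rewrite lt0n dist_eq0 // eq_sym.
have uc : u != c by rewrite -dist_eq0 // dist_sym // du.
have su : side u = ~~ b.
  apply/eqP; apply: contraT => su.
  have := @dist_cut c side x u side_e xc uc; rewrite sx eq_sym su => /(_ isT).
  by rewrite dux (dist_sym u c) du; move: cx_gt0; clear; lia.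
have ecu : e c u by rewrite -dist1 // du.
have Scut y z : y \in S b -> z != c -> side z = ~~ b -> d y c + d c z <= d y z.
  rewrite inE => /andP[yc /eqP sy] zc sz; apply: (dist_cut side_e) => //.
  by rewrite sy sz; case: (b).
have cS : c \notin S b by rewrite inE eqxx.
have near_c : c |: S b \subset nearer c u.
  apply/subsetP => y; rewrite in_setU1 => /predU1P[->|yS]; rewrite inE.
    by rewrite dist_xx // du.
  by have := Scut _ _ yS uc su; rewrite du addn1.
have [le_cu] : #|c |: S b| <= #|nearer c u| by apply: subset_leq_card.
have [le_uc] : m <= #|nearer u c| by rewrite card_nearer_step ?leq_addr // e_sym.
have ncu := card_nearer_step ecu.
rewrite cardsU1 cS in le_cu.
have Sm : #|S b| = m by move: Sb ncu le_cu (leq_b1 (tr c < tr u)); clear; lia.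
have near_u z : z != c -> side z = ~~ b -> d z u < d z c.
  move=> zc sz; have zS : z \notin c |: S b.
    by rewrite !inE (negbTE zc) sz; case: (b).
  have /eqP eq_near : c |: S b == nearer c u.
    by rewrite eqEcard near_c cardsU1 cS Sm ncu /= addnC leq_add2r leq_b1.
  by move: zS; rewrite eq_near inE; case: (dist_edge z ecu); clear; lia.
(* The other side has exactly m > 1 vertices, hence one besides [u]. *)
have [z [zc sz zu]] : exists z, [/\ z != c, side z = ~~ b & z != u].
  have : 1 < #|S (~~ b)| by case: (b) Sm cardS m1 => /=; clear; lia.
  case/card_gt1P => z1 [z2 []]; rewrite !inE => /andP[z1c /eqP s1] /andP[z2c /eqP s2] z12.
  have [z1u|z1u] := eqVneq z1 u; [exists z2 | exists z1] => //.
  by split => //; rewrite -z1u eq_sym.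
have uz_gt0 : 0 < d u z by rewrite lt0n dist_eq0 // eq_sym.
have [w duw dwz] : exists2 w, d u w = 1 & d w z = d u z - 1 by apply: dist_between.
have euw : e u w by rewrite -dist1 // duw.
(* Since [z] is nearer to [u] than to [c], the step from [u] towards [z] does not go back to [c]. *)
have wc : w != c.
  apply: contraTneq (near_u z zc sz) => wc.
  by rewrite -wc !(dist_sym z) dwz -leqNgt leq_subr.
have sw : side w = ~~ b by rewrite -su; apply/esym/side_e.
have near_uw : u |: (c |: S b) \subset nearer u w.
  have dcw : 1 < d c w by have := near_u w wc sw; rewrite (dist_sym w u) (dist_sym w c) duw.
  apply/subsetP => y; rewrite !in_setU1 => /or3P[/eqP->|/eqP->|yS]; rewrite inE.
  - by rewrite dist_xx // duw.
  - by rewrite du.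
  - have := Scut _ _ yS wc sw; have := dist_step y ecu; move: dcw; clear; lia.
have := subset_leq_card near_uw; rewrite card_nearer_step // !cardsU1 cS Sm.
have -> : u \notin c |: S b by rewrite !inE (negbTE uc) su; case: (b).
by have := leq_b1 (tr u < tr w); rewrite /=; clear; lia.
Qed.

(** * The lower bound *)

Section Bipartition.

Variable c : T -> bool.

(** The distance in the complete bipartite graph whose parts are the classes of [c]: 0 on the
    diagonal, 1 across, 2 inside a part. *)
Definition bip_weight u w : nat := (u != w) + ((u != w) && (c u == c w)).

(** The row of [u] sums to n - 2 plus the size of the class of [u]; the terms are arranged to avoid
    subtraction. *)
Lemma sum_bip_weight :
  \sum_u \sum_w bip_weight u w + 2 * #|T| =
    #|T| ^ 2 + #|[set w | c w]| ^ 2 + #|[set w | ~~ c w]| ^ 2.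
Proof.
have row u : \sum_w bip_weight u w + 2 = #|T| + #|[set w | c w == c u]|.
  rewrite -[#|T|]sum1_card -[#|[set w | _]|]sum1dep_card.
  rewrite [\sum_(w | _ == _) 1]big_mkcond -big_split /=.
  rewrite [LHS](_ : _ = \sum_w (bip_weight u w + 2 * (u == w))); last first.
    rewrite [RHS]big_split /=; congr (_ + _).
    by rewrite (bigD1 u) //= eqxx big1 // => w; rewrite eq_sym => /negbTE ->.
  apply: eq_bigr => w _; rewrite /bip_weight [c w == _]eq_sym.
  by have [->|] := eqVneq u w; rewrite ?eqxx //; case: (c u == c w).
have -> : \sum_u \sum_w bip_weight u w + 2 * #|T|
    = \sum_u (#|T| + #|[set w | c w == c u]|).
  under [RHS]eq_bigr do rewrite -row.
  by rewrite big_split sum_nat_const /= mulnC.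
rewrite big_split sum_nat_const /= (_ : #|xpredT| = #|T|) // -addnA; congr (_ + _).
rewrite (bigID c) /=; congr (_ + _).
  rewrite (eq_bigr (fun=> #|[set w | c w]|)) => [|u ->]; last first.
    by apply: eq_card => w; rewrite !inE eqb_id.
  by rewrite sum_nat_const; congr (_ * _); apply: eq_card => w; rewrite !inE.
rewrite (eq_bigr (fun=> #|[set w | ~~ c w]|)) => [|u /negbTE ->]; last first.
  by apply: eq_card => w; rewrite !inE eqbF_neg.
by rewrite sum_nat_const; congr (_ * _); apply: eq_card => w; rewrite !inE.
Qed.

Lemma card_bip : #|[set w | c w]| + #|[set w | ~~ c w]| = #|T|.
Proof.
rewrite -[RHS](cardsC [set w | c w]); congr (_ + _).
by apply: eq_card => w; rewrite !inE.
Qed.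

Lemma complete_bip_dist u w : (forall x y, e x y = (c x != c y)) ->
  d u w = bip_weight u w.
Proof.
move=> ec; rewrite /bip_weight; have [->|uw] := eqVneq u w; first by rewrite dist_xx.
have [cuw|cuw] := eqVneq (c u) (c w); last by apply/eqP; rewrite dist1 // ec.
case duw : (d u w) => [|k]; first by move/eqP: duw uw; rewrite dist_eq0 => /eqP ->; rewrite eqxx.
have [x exw dx] := dist_pred duw.
have /eqP : d u x == 1 by rewrite dist1 // ec cuw -ec e_sym.
by rewrite dx => ->.
Qed.

End Bipartition.

Lemma bip_weight_le u w : bip_weight (fun x => odd (tr x)) u w <= d u w.
Proof.
rewrite /bip_weight; have [->|uw] := eqVneq u w; first by rewrite dist_xx.
have : d u w != 0 by rewrite dist_eq0.
have := dist_odd u w; case: (odd (tr u)); case: (odd (tr w)) => /=; clear; lia.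
Qed.

(** If the parts have m + 1 + j and m - j elements, the sum of squares exceeds its minimum by 2 j (j
    + 1). *)
Lemma card_bip_sq (p q : nat) : p + q = m.*2.+1 ->
  m ^ 2 + m.+1 ^ 2 <= p ^ 2 + q ^ 2 ?= iff ((p == m) || (q == m)).
Proof.
clear; move: m => k pq.
have aux a b j : a = k + j.+1 -> b + j = k ->
    k ^ 2 + k.+1 ^ 2 <= a ^ 2 + b ^ 2 ?= iff (b == k).
  move=> -> <-; have -> : (b + j + j.+1) ^ 2 + b ^ 2
      = (b + j) ^ 2 + (b + j).+1 ^ 2 + 2 * (j * j.+1) by nia.
  split; first by rewrite leq_addr.
  rewrite -[X in X == _]addn0 eqn_add2l; case: j => [|j]; first by rewrite addn0 !eqxx.
  by apply/eqP/eqP; lia.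
have [pk|kp] := leqP p k.
  rewrite [p ^ 2 + _]addnC [q == k](_ : _ = false) ?orbF; last by apply/eqP; lia.
  by apply: (aux q p (k - p)); lia.
rewrite [p == k](_ : _ = false) /=; last by apply/eqP; lia.
by apply: (aux p q (k - q)); lia.
Qed.

Lemma transmissionE v : tr v = \sum_w d v w.
Proof. by apply: eq_bigr => w _; apply: dist_sym. Qed.

Lemma sum_tr_dist : \sum_u tr u = \sum_u \sum_w d u w.
Proof. by apply: eq_bigr => u _; apply: eq_bigr => w _; apply: dist_sym. Qed.

Lemma sum_tr_lower : 2 * (3 * m ^ 2 + m) <= \sum_u tr u.
Proof.
apply: (@leq_trans (\sum_u \sum_w bip_weight (fun x => odd (tr x)) u w)).
  have := sum_bip_weight (fun x => odd (tr x)).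
  have := card_bip (fun x => odd (tr x)); rewrite [X in _ = X]card_odd.
  move=> /card_bip_sq[le _]; move: le; have := card_odd; clear.
  move: #|T| m (\sum_u _) #|_| #|_| => n k S p q -> /=; nia.
rewrite sum_tr_dist; apply: leq_sum => u _; apply: leq_sum => w _.
exact: bip_weight_le.
Qed.

Definition balanced_bip (c : T -> bool) :=
  #|[set w | c w]| = m /\ forall x y, e x y = (c x != c y).

Lemma sum_tr_lower_eq :
  \sum_u tr u = 2 * (3 * m ^ 2 + m) <-> exists c, balanced_bip c.
Proof.
split=> [eqS|[c [cm ec]]]; last first.
  rewrite sum_tr_dist; under eq_bigr do under eq_bigr do rewrite (complete_bip_dist _ _ ec).
  have := sum_bip_weight c; have := card_bip c; rewrite cm.
  have := card_odd; clear; move: #|T| m (\sum_u _) #|_| => n k S q -> /=; nia.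
pose c x := odd (tr x).
have cardc := card_bip c; rewrite [X in _ = X]card_odd in cardc.
have [le eq_iff] := card_bip_sq cardc.
have leS : \sum_u \sum_w bip_weight c u w <= \sum_u \sum_w d u w.
  by apply: leq_sum => u _; apply: leq_sum => w _; apply: bip_weight_le.
have sumw := sum_bip_weight c.
(* Equality of the totals leaves no slack in either estimate: weights against distances, and the
   sizes of the parts. *)
have [eqW eqPQ] : \sum_u \sum_w bip_weight c u w = \sum_u \sum_w d u w
    /\ m ^ 2 + m.+1 ^ 2 == #|[set w | c w]| ^ 2 + #|[set w | ~~ c w]| ^ 2.
  rewrite sum_tr_dist in eqS; move: leS sumw le; rewrite eqS; have := card_odd; clear.
  move: (#|[set w | c w]| ^ 2) (#|[set w | ~~ c w]| ^ 2) => p q.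
  by move: #|T| m (\sum_u _) => n k S -> leS eS le; split; [|apply/eqP]; nia.
have dW u w : d u w = bip_weight c u w.
  have := leqif_sum (fun u (_ : true) => leqif_sum (fun w (_ : true) =>
    conj (bip_weight_le u w) (erefl (bip_weight c u w == d u w)))).
  case=> _; rewrite eqW eqxx => /esym/forallP/(_ u)/forallP/(_ w)/eqP.
  by [].
have ec x y : e x y = (c x != c y).
  rewrite -dist1 // dW /bip_weight; have [->|] := eqVneq x y; first by rewrite eqxx.
  by case: (c x == c y).
have : (#|[set w | c w]| == m) || (#|[set w | ~~ c w]| == m).
  by rewrite -eq_iff.
(* Either colour class may be the smaller one; in the second case the colours are exchanged. *)
case/orP=> /eqP cm; first by exists c.
exists (fun x => ~~ c x); split=> // x y; rewrite ec.
by case: (c x); case: (c y).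
Qed.

Lemma balanced_bip_iso :
  (exists c, balanced_bip c) <-> graph_iso e (@complete_bipartite m m.+1).
Proof.
split=> [[c [cA ec]]|[f [[g fK gK] fe]]].
  have cB : #|[set w | ~~ c w]| = m.+1.
    by have := card_bip c; have := card_odd; rewrite cA; clear; lia.
  pose g (s : 'I_m + 'I_m.+1) : T := match s with
    | inl i => enum_val (cast_ord (esym cA) i)
    | inr j => enum_val (cast_ord (esym cB) j) end.
  have cg s : c (g s) = if s is inl _ then true else false.
    case: s => i /=; first by have := enum_valP (cast_ord (esym cA) i); rewrite inE.
    by have := enum_valP (cast_ord (esym cB) i); rewrite inE => /negbTE.
  have g_inj : injective g.
    move=> s t gst; have := congr1 c gst; rewrite !cg.
    by case: s t gst => i [] j //= /enum_val_inj/cast_ord_inj ->.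
  have [|f fK gK] := inj_card_bij g_inj.
    by rewrite card_sum !card_ord; have := card_odd; clear; lia.
  exists f; split; first by exists g.
  move=> x y; rewrite ec -{2}[x]gK -{2}[y]gK !cg.
  by case: (f x); case: (f y).
exists (fun w => if f w is inl _ then true else false); split=> [|x y]; last first.
  by rewrite -fe; case: (f x); case: (f y).
have -> : [set w | if f w is inl _ then true else false] = [set g (inl i) | i in 'I_m].
  apply/setP => w; rewrite inE; apply/idP/imsetP => [|[i _ ->]]; last by rewrite gK.
  by case fw: (f w) => [i|//] _; exists i => //; rewrite -fw fK.
by rewrite card_imset ?card_ord // => i j /(can_inj gK)[].
Qed.

(** For n = 3 a vertex has a neighbour and its other distance is at most 2, so each transmission is
    at most 3. The sum is then at most 9 and, being twice the Wiener index, at most 8. *)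
Lemma sum_tr_upper_small : m <= 1 -> \sum_u tr u <= 2 * (m ^ 3 + m ^ 2 + 2).
Proof.
rewrite leq_eqVlt ltnS leqn0 => /orP[/eqP m1|/eqP m0]; last first.
  rewrite big1 // => u _; rewrite transmissionE big1 // => w _.
  by apply/eqP; rewrite -leqn0 -ltnS; have := dist_lt_card u w; rewrite [X in _ < X]card_odd m0.
have n3 : #|T| = 3 by have := card_odd; rewrite m1.
have tr3 w : tr w <= 3.
  have [y wy] : exists y, y != w.
    have : 0 < #|[set~ w]| by rewrite cardsC1 n3.
    by case/card_gt0P=> y; rewrite !inE; exists y.
  have [|x dx _] := @dist_between w y 1; first by rewrite lt0n dist_eq0 eq_sym.
  have xw : x != w by rewrite eq_sym -dist_eq0 dx.
  have : \sum_y (d w y + (y == x)) <= \sum_y 2 * (y != w).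
    apply: leq_sum => z _; have [->|zx] := eqVneq z x; first by rewrite dx xw.
    have [->|zw] := eqVneq z w; first by rewrite dist_xx.
    by rewrite addn0; have := dist_lt_card w z; rewrite n3.
  rewrite big_split /= -transmissionE -big_distrr /=.
  have -> : \sum_y ((y == x) : nat) = 1.
    by rewrite (bigD1 x) //= eqxx big1 // => z /negbTE ->.
  have -> : \sum_y ((y != w) : nat) = 2.
    by rewrite -big_mkcond (eq_bigl (mem [set~ w])) => [|z]; rewrite ?sum1_card ?cardsC1 ?n3 ?inE.
  by rewrite addn1.
have [W WE] : exists W, \sum_u tr u = W.*2 by exists (wiener e); rewrite -wiener_transmission.
have : \sum_u tr u <= \sum_(u : T) 3 by apply: leq_sum.
by rewrite m1 sum_nat_const n3 WE; clear; lia.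
Qed.

(** * Distance levels *)

Definition level v k := [set w | d v w == k].
Definition tail v k := #|[set w | k < d v w]|.

Lemma tailS v k : tail v k = #|level v k.+1| + tail v k.+1.
Proof.
rewrite -cardsUI -[LHS]addn0; congr (_ + _).
  by apply: eq_card => w; rewrite !inE; lia.
by apply/esym/eqP; rewrite cards_eq0; apply/eqP/setP => w; rewrite !inE; lia.
Qed.

Lemma tail0 v : tail v 0 = m.*2.
Proof.
have : #|[set~ v]| = m.*2 by rewrite cardsC1; have := card_odd; lia.
by move=> <-; apply: eq_card => w; rewrite !inE lt0n dist_eq0 eq_sym.
Qed.

(** Layer-cake summation: [w] is counted in [tail v k] once for each k below its truncated
    distance. *)
Lemma sum_minn_dist v r : \sum_w minn (d v w) r = \sum_(k < r) tail v k.
Proof.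
elim: r => [|r IH]; first by rewrite big_ord0 big1 // => w _; rewrite minn0.
rewrite big_ord_recr /= -IH /tail -sum1dep_card [X in _ + X]big_mkcond -big_split /=.
by apply: eq_bigr => w _; case: ifP; lia.
Qed.

Lemma tr_lipschitz u w : tr w <= tr u + d u w.
Proof.
have [k dk] : exists k, d u w = k by exists (d u w).
rewrite dk; elim: k w dk => [|k IH] w dk.
  by move/eqP: dk; rewrite dist_eq0 => /eqP ->; lia.
by have [x exw dx] := dist_pred dk; have := IH x dx; case: (tr_step exw) => ->; lia.
Qed.

Lemma card2_eq (A : {set T}) x y z :
  #|A| = 2 -> x \in A -> y \in A -> x != y -> z \in A -> z = x \/ z = y.
Proof.
move=> cA xA yA xy zA; have /eqP eA : [set x; y] == A.
  by rewrite eqEcard cA cards2 xy andbT; apply/subsetP => t /set2P[] ->.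
by move: zA; rewrite -eA => /set2P.
Qed.

Lemma sum_max_tail k r : r <= k -> \sum_(j < r) (k.*2 - j.*2) + r * r = k * r.*2 + r.
Proof.
elim: r => [|r IH] lt; first by rewrite big_ord0 double0 !muln0.
rewrite big_ord_recr /=; move: lt (IH (ltnW lt)); clear.
by move: (\sum_(j < r) _) => S; nia.
Qed.

Hypothesis m_gt1 : 1 < m.

(** If [c] were the only vertex of a level that is not the last, every path from [v] to the later
    levels would cross [c]. *)
Lemma level_ge2 v k : 0 < k -> 0 < tail v k -> 1 < #|level v k|.
Proof.
move=> k0 /card_gt0P[y]; rewrite inE => ky; rewrite ltnNge; apply/negP => le1.
have [c dc _] := dist_between (ltnW ky).
have cL z : d v z = k -> z = c.
  move=> dz; apply/eqP; apply: contraLR le1 => zc.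
  by rewrite -ltnNge; apply/card_gt1P; exists z, c; rewrite !inE dz dc eqxx.
suff: (d v v < k) = (d v y < k) by rewrite dist_xx k0 ltnNge (ltnW ky).
apply: (@no_cut_vertex c (fun z => d v z < k) v y m_gt1) => [z w zc wc ezw||].
- have zk : d v z != k by apply: contraNneq zc => /cL ->.
  have wk : d v w != k by apply: contraNneq wc => /cL ->.
  by case: (dist_edge v ezw); move: zk wk; clear; lia.
- by rewrite -dist_eq0 dc -lt0n.
- by apply: contraTneq ky => ->; rewrite dc ltnn.
Qed.

Lemma tail_le v k : tail v k <= m.*2 - k.*2.
Proof.
elim: k => [|k IH]; first by rewrite tail0 subn0.
have := @level_ge2 v k.+1 isT; have := tailS v k; move: IH; clear; lia.
Qed.

Lemma tail_m v : tail v m = 0.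
Proof. by have := tail_le v m; rewrite subnn leqn0 => /eqP. Qed.

Lemma dist_le_half v w : d v w <= m.
Proof.
rewrite leqNgt; apply/negP => lt.
have : 0 < tail v m by apply/card_gt0P; exists w; rewrite inE.
by rewrite tail_m.
Qed.

Lemma tr_tail v : tr v = \sum_(k < m) tail v k.
Proof.
rewrite -sum_minn_dist transmissionE; apply: eq_bigr => w _.
by rewrite (minn_idPl (dist_le_half v w)).
Qed.

(** Each later level that is not the last still takes two vertices, so a tail below its maximum at k
    stays below it for all j with k <= j < m. This costs m - k out of m (m + 1). *)
Lemma tr_gap v k : k < m -> tail v k < m.*2 - k.*2 -> tr v <= m ^ 2 + k.
Proof.
move=> km gap.
have gapj j : k <= j -> j < m -> tail v j < m.*2 - j.*2.
  elim: j => [|j IH] kj jm; first by move: kj; rewrite leqn0 => /eqP <-.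
  move: kj; rewrite leq_eqVlt => /predU1P[<- //|kj].
  have := IH kj (ltnW jm); have := @level_ge2 v j.+1 isT; have := tailS v j.
  by move: jm; clear; lia.
have : \sum_(j < m) (tail v j + (k <= j)) <= \sum_(j < m) (m.*2 - j.*2).
  apply: leq_sum => j _; have [kj|_] := leqP k j.
    by rewrite addn1 gapj.
  by rewrite addn0 tail_le.
rewrite big_split /= -tr_tail.
have -> : \sum_(j < m) (k <= j) = m - k.
  rewrite -(big_mkord xpredT (fun j => nat_of_bool (k <= j))).
  rewrite (big_cat_nat (n := k)) //=; last exact: ltnW.
  rewrite big_nat big1 => [|j /andP[_ jk]]; last by rewrite leqNgt jk.
  rewrite add0n big_nat (eq_bigr (fun=> 1)) => [|j /andP[-> _] //].
  by rewrite -big_nat sum_nat_const_nat muln1.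
have := sum_max_tail (leqnn m); move: km; clear.
by set S := \sum_(j < m) _; nia.
Qed.

Lemma tr_max v : tr v <= m * m.+1.
Proof.
rewrite tr_tail; have := sum_max_tail (leqnn m).
have : \sum_(j < m) tail v j <= \sum_(j < m) (m.*2 - j.*2).
  by apply: leq_sum => j _; apply: tail_le.
clear; set S := \sum_(j < m) _; set S' := \sum_(j < m) _.
by nia.
Qed.

(** * Neighbours and vertices of degree two *)

Lemma two_neighbours w : exists x y, [/\ x != y, e w x & e w y].
Proof.
have : 1 < #|level w 1|.
  have := @level_ge2 w 1 isT; have := tailS w 0; rewrite tail0.
  by move: m_gt1; clear; lia.
case/card_gt1P=> x [y []]; rewrite !inE !dist1 // => ex ey xy.
by exists x, y.
Qed.

Lemma deg2_cover p q w z : (forall y, e p y -> y = q \/ y = w) ->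
  z != p -> (z \in nearer q p) || (z \in nearer w p).
Proof.
move=> Np zp; have dzp : d z p != 0 by rewrite dist_eq0.
case dz : (d z p) dzp => [//|j] _.
have [y eyp dy] := dist_pred dz; rewrite !inE dz.
by case: (Np y _) => [|<-|<-]; rewrite ?dy ?ltnSn ?orbT // e_sym.
Qed.

(* Otherwise each of q and w is nearer than p to exactly half of the other
   vertices; these two halves would be disjoint and separated by p. *)
Lemma deg2_no_min p q w : e p q -> e p w ->
  (forall z, e p z -> z = q \/ z = w) -> tr p < tr q -> tr w < tr p.
Proof.
move=> epq epw Np lt_pq.
have eqp : e q p by rewrite e_sym.
have ewp : e w p by rewrite e_sym.
have cover := deg2_cover Np.
have [z zq zw] : exists2 z, z \in nearer q p & z \in nearer w p.
  suff: ~~ [disjoint nearer q p & nearer w p].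
    by case/pred0Pn=> z /andP[? ?]; exists z.
  apply/negP => dis.
  have nq z : z \in nearer q p -> z \in nearer w p -> False.
    by move=> zq; rewrite (disjointFr dis zq).
  suff: (q \in nearer q p) = (w \in nearer q p).
    have qq : q \in nearer q p.
      rewrite inE dist_xx dist_sym lt0n dist_eq0.
      by apply: contraTneq epq => ->; rewrite e_irr.
    have ww : w \in nearer w p.
      rewrite inE dist_xx dist_sym lt0n dist_eq0.
      by apply: contraTneq epw => ->; rewrite e_irr.
    by rewrite qq => /esym/nq; apply.
  apply: (@no_cut_vertex p (fun z => z \in nearer q p) q w m_gt1) => [x y xp yp exy||].
  - have aux a b : a != p -> b != p -> e a b -> a \in nearer q p -> b \in nearer q p.
      move=> ap bp eab aq; have [//|bq] := boolP (b \in nearer q p).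
      have bw := cover b bp; rewrite (negbTE bq) /= in bw.
      have eba : e b a by rewrite e_sym.
      case: (dist_edge p eab); rewrite !(dist_sym p) => dab.
        have := dist_step q eab; rewrite !(dist_sym q).
        by move: aq bq; rewrite !inE dab; clear; lia.
      case: (@nq a aq); have := dist_step w eba; rewrite !(dist_sym w).
      by move: bw; rewrite !inE dab; clear; lia.
    by apply/idP/idP; apply: aux => //; rewrite e_sym.
  - by apply: contraTneq epq => ->; rewrite e_irr.
  - by apply: contraTneq epw => ->; rewrite e_irr.
(* The two sets cover all vertices but [p] and share [z]. As [tr p < tr q], the first has only m
   elements, so the second has m + 1. *)
have : m.*2.+1 <= #|nearer q p| + #|nearer w p|.
  rewrite -cardsUI -addn1 leq_add //; last first.
    by apply/card_gt0P; exists z; rewrite in_setI zq.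
  have <- : #|[set~ p]| = m.*2 by rewrite cardsC1; have := card_odd; clear; lia.
  by apply: subset_leq_card; apply/subsetP => y; rewrite in_setC1 in_setU; apply: cover.
rewrite !card_nearer_step // (ltnNge (tr q)) (ltnW lt_pq).
by case: (tr w < tr p) => //=; clear; lia.
Qed.

(** * Vertices whose first r levels have two elements *)

Section Tight.

Variables (v : T) (r : nat).
Hypotheses (r_lt : r < m) (tight : forall k, k <= r -> tail v k = m.*2 - k.*2).

Lemma card_level k : 0 < k <= r -> #|level v k| = 2.
Proof.
case: k => [//|k] /= kr; have := tailS v k; rewrite !tight //; last exact: ltnW.
by move: kr r_lt; clear; lia.
Qed.

(** If [w] saw both vertices of level k + 1, everything beyond level k would be reached through [w],
    hence be nearer to [a], the first vertex of a shortest path from [v] to [w], than to [v]. With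
    the k vertices of that path from [a] to [w], this makes 2m - k > m + 1 vertices nearer to
    [a]. *)
Lemma up_unique k w x y : 0 < k < r -> d v w = k -> e w x -> e w y ->
  d v x = k.+1 -> d v y = k.+1 -> x = y.
Proof.
case/andP=> k0 kr dw ewx ewy dx dy; apply/eqP; apply: contraT => xy.
have [a da daw] : exists2 a, d v a = 1 & d a w = k - 1.
  by rewrite -dw; apply: dist_between; rewrite dw.
have near_tail z : k < d v z -> d a z < d v z.
  move=> kz; have [u du duz] := dist_between kz.
  have ewu : e w u.
    have [] := @card2_eq (level v k.+1) x y u _ _ _ xy _; rewrite ?inE ?dx ?dy ?du //.
    - by apply: card_level.
    - by move=> ->.
    - by move=> ->.
  have := dist_triangle a w z; have := dist_triangle w u z.
  move: ewu; rewrite -dist1 // => /eqP ->; move: kz k0; rewrite daw duz; clear; lia.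
have chain (i : 'I_k) : exists z, (d a z == i) && (d v z == i.+1).
  have [z dz dzw] : exists2 z, d a z = i & d z w = d a w - i.
    by apply: dist_between; rewrite daw; have := ltn_ord i; clear; lia.
  exists z; rewrite dz eqxx /=.
  have := dist_triangle v a z; have := dist_triangle v z w.
  by rewrite dz da dw dzw daw; have := ltn_ord i; clear; lia.
pose f i := xchoose (chain i).
have fP i : d a (f i) = i /\ d v (f i) = i.+1.
  by have /andP[/eqP ? /eqP ?] := xchooseP (chain i).
have f_inj : injective f.
  by move=> i j fij; apply: val_inj => /=; rewrite -(fP i).1 -(fP j).1 fij.
have sub : [set f i | i in 'I_k] :|: [set z | k < d v z] \subset nearer a v.
  apply/subsetP => z; rewrite in_setU !inE => /orP[/imsetP[i _ ->]|/near_tail].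
    by rewrite !(dist_sym (f i)) (fP i).1 (fP i).2.
  by rewrite !(dist_sym z).
have eav : e a v by rewrite -dist1 // dist_sym da.
have := subset_leq_card sub; rewrite card_nearer_step // cardsU.
rewrite disjoint_setI0; last first.
  rewrite disjoints_subset; apply/subsetP => z /imsetP[i _ ->].
  by rewrite !inE (fP i).2 -leqNgt.
rewrite cards0 subn0 card_imset // card_ord -/(tail v k) tight; last exact: ltnW.
by have := leq_b1 (tr a < tr v); move: k0 kr r_lt; clear; lia.
Qed.

(** If [w] saw both vertices of the level below, the other vertex [w'] of its own level would share
    a lower neighbour with it, contrary to [up_unique]. *)
Lemma down_unique k w x y : 0 < k <= r -> d v w = k -> e w x -> e w y ->
  d v x = k.-1 -> d v y = k.-1 -> x = y.
Proof.
case/andP=> k0 kr dw ewx ewy dx dy; case: k => [//|[|k]] in k0 kr dw dx dy *.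
  by move/eqP: dx; move/eqP: dy; rewrite /= !dist_eq0 => /eqP <- /eqP <-.
apply/eqP; apply: contraT => xy.
have [w' dw' w'w] : exists2 w', d v w' = k.+2 & w' != w.
  have /card_gt1P[z1 [z2 []]] : 1 < #|level v k.+2| by rewrite card_level.
  rewrite !inE => /eqP d1 /eqP d2 z12; have [z1w|z1w] := eqVneq z1 w; last by exists z1.
  by exists z2; rewrite // -z1w eq_sym.
have [q eqw' dq] := dist_pred dw'.
have exw : e x w by rewrite e_sym.
have eyw : e y w by rewrite e_sym.
have [] := @card2_eq (level v k.+1) x y q _ _ _ xy _; rewrite ?inE ?dx ?dy ?dq //.
- by apply: card_level; apply: ltnW.
- by move=> qx; move: w'w; rewrite (@up_unique k.+1 x w' w) ?eqxx // -qx.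
- by move=> qy; move: w'w; rewrite (@up_unique k.+1 y w' w) ?eqxx // -qy.
Qed.

Hypothesis v_max : forall w, tr w <= tr v.

(** Maximality of [v] settles level 1. Beyond it, an inner vertex [p] has degree 2 by the two
    uniqueness lemmas, and its lower neighbour has larger transmission, so [deg2_no_min] makes that
    of the upper one smaller. *)
Lemma tr_descent w : d v w <= r -> tr w + d v w = tr v.
Proof.
have [k dk] : exists k, d v w = k by exists (d v w).
rewrite dk; elim/ltn_ind: k w dk => -[|k] IH w dk kr.
  by move/eqP: dk; rewrite dist_eq0 => /eqP <-; rewrite addn0.
have [p epw dp] := dist_pred dk; have := IH k (ltnSn k) p dp (ltnW kr).
case: k => [|k] in IH dk kr dp *.
  move/eqP: dp; rewrite dist_eq0 => /eqP vp; have := v_max w; rewrite -vp in epw *.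
  by case: (tr_step epw); clear; lia.
have [q eqp dq] := dist_pred dp.
have trq := IH k _ q dq _; move: trq; rewrite -(leq_add2r 2) !addn2.
move=> /(_ (leqnSn _) (ltnW (ltnW kr))) trq trp.
suff: tr w < tr p.
  by case: (tr_step epw); move: trp; clear; lia.
have epq : e p q by rewrite e_sym.
apply: (@deg2_no_min p q w) => //; last by move: trq trp; clear; lia.
move=> z epz; case: (dist_edge v epz) => dz.
  by right; apply: (@up_unique k.+1 p) => //; rewrite dz dp.
by left; apply: (@down_unique k.+1 p) => //; rewrite ?(ltnW kr) //; move: dz; rewrite dp => -[].
Qed.

(** Beyond level r the transmission may rise again by 1 per edge. Adding [d v w] makes the bound
    constant up to level r. *)
Lemma tr_bound w : tr w + d v w <= tr v + 2 * (d v w - r).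
Proof.
have [kr|kr] := leqP (d v w) r; first by rewrite tr_descent // leq_addr.
have [u du duw] := dist_between (ltnW kr).
have := @tr_descent u; rewrite du => /(_ (leqnn _)).
by have := tr_lipschitz u w; rewrite duw; move: kr; clear; lia.
Qed.

Lemma sum_excess : \sum_w (d v w - r) + 2 * m * r + r = tr v + r * r.
Proof.
have : \sum_w (d v w - r) + \sum_w minn (d v w) r = tr v.
  rewrite -big_split transmissionE; apply: eq_bigr => w _ /=.
  by case: (leqP (d v w) r) => h; rewrite ?subnK // ?(ltnW h) //; move: h; clear; lia.
rewrite sum_minn_dist (eq_bigr (fun k : 'I_r => m.*2 - k.*2)) => [|k _]; last first.
  by rewrite tight // ltnW.
have := sum_max_tail (ltnW r_lt); clear.
by move: (\sum_(j < r) _) (\sum_w _) => A B; nia.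
Qed.

Lemma sum_tr_bound :
  \sum_w tr w + tr v + 4 * m * r + 2 * r <= #|T| * tr v + 2 * tr v + 2 * r * r.
Proof.
have : \sum_w (tr w + d v w) <= \sum_w (tr v + 2 * (d v w - r)).
  by apply: leq_sum => w _; apply: tr_bound.
rewrite !big_split /= sum_nat_const big1_eq addn0 -transmissionE.
rewrite (_ : #|xpredT| = #|T|) //.
have := sum_excess; clear.
by move: (\sum_w (_ - _)) (\sum_w tr w) => A B; nia.
Qed.

End Tight.

(** * Extremal transmission and the hatted cycle *)

Section Top.

Variable v : T.
Hypothesis v_top : tr v = m * m.+1.

Lemma top_tight k : k <= m.-1 -> tail v k = m.*2 - k.*2.
Proof.
move=> km; apply/eqP; rewrite eqn_leq tail_le leqNgt; apply/negP => lt.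
have km' : k < m by move: km m_gt1; clear; lia.
by have := tr_gap km' lt; rewrite v_top; move: km'; clear; nia.
Qed.

Lemma pred_half_lt : m.-1 < m.
Proof. by rewrite prednK // ltnW. Qed.

Lemma top_card_level k : 0 < k <= m -> #|level v k| = 2.
Proof.
case/andP=> k0; rewrite leq_eqVlt => /predU1P[->|km].
  have := tailS v m.-1; rewrite prednK ?(ltnW m_gt1) // tail_m top_tight //.
  by move: m_gt1; clear; lia.
by apply: (card_level pred_half_lt top_tight); move: k0 km; clear; lia.
Qed.

Lemma top_max w : tr w <= tr v.
Proof. by rewrite v_top tr_max. Qed.

Lemma top_neighbour x y : d v x = m -> e x y -> d v y = m.-1.
Proof.
move=> dx exy; case: (dist_edge v exy); rewrite dx => dy; last by rewrite dy.
by have := dist_le_half v y; rewrite dy ltnn.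
Qed.

Lemma top_adj x p : d v x = m -> d v p = m.-1 -> e x p.
Proof.
move=> dx dp; have [y [z [yz exy exz]]] := two_neighbours x.
have [] := @card2_eq (level v m.-1) y z p _ _ _ yz _; rewrite ?inE ?dp ?(top_neighbour dx) //.
- by apply: top_card_level; move: m_gt1; clear; lia.
- by move=> ->.
- by move=> ->.
Qed.

(** The transmission rises again on the last step. The two neighbours [p] and [q] of [x] are the
    whole level m - 1, and both [v] and the twin [y] of [x] are nearer to each of them than to [x].
    Two sets that cover 2m vertices and share two must both have m + 1 elements. *)
Lemma tr_top x : d v x = m -> tr x + m = tr v + 2.
Proof.
move=> dx; have [p [q [pq exp exq]]] := two_neighbours x.
have dp := top_neighbour dx exp; have dq := top_neighbour dx exq.
have [y yx dy] : exists2 y, y != x & d v y = m.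
  have /card_gt1P[z1 [z2 []]] : 1 < #|level v m| by rewrite top_card_level // leqnn andbT ltnW.
  rewrite !inE => /eqP d1 /eqP d2 z12; have [z1x|z1x] := eqVneq z1 x; last by exists z1.
  by exists z2; rewrite // -z1x eq_sym.
have Np z : e x z -> z = p \/ z = q.
  move=> exz; apply: (@card2_eq (level v m.-1)); rewrite ?inE ?dp ?dq ?(top_neighbour dx exz) //.
  by apply: top_card_level; move: m_gt1; clear; lia.
have epx : e p x by rewrite e_sym.
have eqx : e q x by rewrite e_sym.
have near_v : v \in nearer p x :&: nearer q x by rewrite !inE dp dq dx pred_half_lt.
have near_y : y \in nearer p x :&: nearer q x.
  have near z : e x z -> y \in nearer z x.
    move=> exz; have dyz : d y z = 1.
      by apply/eqP; rewrite dist1 //; apply: top_adj => //; apply: top_neighbour exz.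
    rewrite inE dyz; have : d y x != 0 by rewrite dist_eq0.
    by case: (dist_edge y exz); rewrite dyz; clear; lia.
  by rewrite in_setI !near.
have vy : v != y by apply: contraTneq m_gt1 => vy; rewrite -dy -vy dist_xx.
have lt_px : tr p < tr x.
  have cap : 1 < #|nearer p x :&: nearer q x| by apply/card_gt1P; exists v, y.
  have cup : m.*2 <= #|nearer p x :|: nearer q x|.
    have <- : #|[set~ x]| = m.*2 by rewrite cardsC1; have := card_odd; clear; lia.
    apply: subset_leq_card; apply/subsetP => z; rewrite in_setC1 in_setU.
    exact: deg2_cover.
  have := cardsUI (nearer p x) (nearer q x); rewrite !card_nearer_step //.
  by move: cap cup; case: (tr p < tr x) => //=; case: (tr q < tr x); clear; lia.
have := tr_descent pred_half_lt top_tight top_max; move=> /(_ p); rewrite dp => /(_ (leqnn _)).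
by case: (tr_step exp); move: lt_px m_gt1; clear; lia.
Qed.

(** With r = m - 1, [tr_bound] is an equality at every vertex, the last level included by
    [tr_top]. *)
Lemma top_sum_tr : \sum_w tr w = 2 * (m ^ 3 + m ^ 2 + 2).
Proof.
have : \sum_w (tr w + d v w) = \sum_w (tr v + 2 * (d v w - m.-1)).
  apply: eq_bigr => w _; have [le|lt] := leqP (d v w) m.-1.
    rewrite (tr_descent pred_half_lt top_tight top_max) //.
    by have /eqP -> : d v w - m.-1 == 0; rewrite ?muln0 ?addn0.
  have dw : d v w = m by have := dist_le_half v w; move: lt; clear; lia.
  by have := tr_top dw; rewrite dw; move: m_gt1; clear; lia.
rewrite !big_split /= sum_nat_const big1_eq addn0 -transmissionE.
rewrite (_ : #|xpredT| = #|T|) //.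
have := sum_excess pred_half_lt top_tight; rewrite v_top.
have := card_odd; move: m_gt1; clear.
move: (\sum_w (_ - _)) (\sum_w tr w) => A B.
move: #|T| m => n [//|k] k1 -> /=.
nia.
Qed.

(** * Rebuilding the hatted cycle from the levels *)

Section Coordinates.

Variables a x : T.
Hypotheses (eva : e v a) (dx : d v x = m).

(** On the levels strictly between 0 and m, this says that [w] is on the branch that starts with
    [a]. *)
Definition near_a w := d a w < d v w.

Lemma near_a_child w u : e w u -> 0 < d v w -> d v u = (d v w).+1 -> d v u < m ->
  near_a u = near_a w.
Proof.
move=> ewu dw0 du um; apply/idP/idP; rewrite /near_a => lt.
  have da : d v a = 1 by apply/eqP; rewrite dist1.
  have dau : d a u = d v w.
    by have := dist_triangle v a u; move: lt; rewrite da du; clear; lia.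
  have [y eyu dy] : exists2 y, e y u & d a y = (d v w).-1 by apply: dist_pred; rewrite dau prednK.
  have dvy : d v y = d v w.
    have := dist_triangle v a y; rewrite da dy.
    by case: (dist_edge v eyu); rewrite du; move: dw0; clear; lia.
  suff -> : w = y by rewrite dvy dy; move: dw0; clear; lia.
  apply: (@down_unique _ _ pred_half_lt top_tight (d v u) u) => //; rewrite ?du ?dvy //= 1?e_sym //.
  by move: um; rewrite du; clear; lia.
by have := dist_step a ewu; move: lt; rewrite du; clear; lia.
Qed.

Lemma near_a_inj w u : 0 < d v w < m -> d v u = d v w -> near_a w = near_a u -> w = u.
Proof.
have [k dk] : exists k, d v w = k by exists (d v w).
rewrite dk; elim: k w u dk => [//|k IH] w u dw /= km du near_eq.
case: k => [|k] in IH dw km du *.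
  have va : v != a by apply: contraTneq eva => <-; rewrite e_irr.
  have near1 z : d v z = 1 -> near_a z = (z == a).
    by move=> dz; rewrite /near_a dz ltnS leqn0 dist_eq0 eq_sym.
  move: near_eq; rewrite !near1 //; have [-> /esym/eqP //|wa /esym/negbT ua] := eqVneq w a.
  apply/eqP; apply: contraT => wu.
  have [] := @card2_eq (level v 1) w u a _ _ _ wu _; rewrite ?inE ?dw ?du ?dist1 ?eva //.
  - by apply: top_card_level; apply: ltnW.
  - by move=> aw; rewrite -aw eqxx in wa.
  - by move=> au; rewrite -au eqxx in ua.
have [p epw dp] := dist_pred dw; have [q equ dq] := dist_pred du.
have pq : p = q.
  apply: IH => //; first exact: ltnW.
  by rewrite -(near_a_child epw) -?(near_a_child equ) ?dp ?dw ?dq ?du.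
apply: (@up_unique _ _ pred_half_lt top_tight k.+1 p) => //; last by rewrite pq.
by move: km; clear; lia.
Qed.

(** The root gets [true], the only side allowed at level 0. On the last level the branches have met,
    so the chosen vertex [x] tells the twins apart. *)
Definition side w : bool :=
  if d v w == m then w == x else (w == v) || near_a w.

Lemma side_valid w : (0 < d v w) || side w.
Proof.
rewrite lt0n dist_eq0 eq_sym; have [->|//] := eqVneq w v.
by rewrite /side dist_xx eqxx; case: eqP => // m0; move: m_gt1; rewrite -m0.
Qed.

Lemma side_mid w : 0 < d v w < m -> side w = near_a w.
Proof.
case/andP=> w0 wm; rewrite /side (ltn_eqF wm).
by move: w0; rewrite lt0n dist_eq0 eq_sym => /negbTE ->.
Qed.

Lemma coord_inj w u : d v w = d v u -> side w = side u -> w = u.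
Proof.
move=> dwu; have [dw0|] := posnP (d v w).
  by move/eqP: dwu; rewrite dw0 eq_sym; move/eqP: dw0; rewrite !dist_eq0 => /eqP <- /eqP <-.
move=> dw0; have [wm|dwm] := eqVneq (d v w) m; last first.
  have lt : 0 < d v w < m by rewrite dw0 ltn_neqAle dwm dist_le_half.
  by rewrite !side_mid -?dwu // => near_eq; apply: near_a_inj.
rewrite /side -dwu wm eqxx; have [-> /esym/eqP //|wx /esym/negbT ux] := eqVneq w x.
have um : d v u = m by rewrite -dwu.
apply/eqP; apply: contraT => wu.
have [] := @card2_eq (level v m) w u x _ _ _ wu _; rewrite ?inE ?wm ?um ?dx //.
- by apply: top_card_level; rewrite leqnn andbT ltnW.
- by move=> xw; rewrite xw eqxx in wx.
- by move=> xu; rewrite xu eqxx in ux.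
Qed.

Lemma edge_up w u : d v u = (d v w).+1 ->
  e w u = [|| d v w == 0, d v u == m | side w == side u].
Proof.
move=> du; have [dw0|dw0] := posnP (d v w).
  by move/eqP: (dw0); rewrite dist_eq0 => /eqP <-; rewrite -dist1 // du dw0.
have [um|um] /= := eqVneq (d v u) m.
  by rewrite e_sym; apply: top_adj => //; rewrite -um du.
have lt_um : d v u < m by rewrite ltn_neqAle um dist_le_half.
have lt_wm : 0 < d v w < m by rewrite dw0 ltnW // -du.
rewrite !side_mid //; last by rewrite lt_um du.
apply/idP/eqP => [ewu|near_eq]; first by rewrite (near_a_child ewu).
have [p epu dp] := dist_pred du.
suff -> : w = p by [].
apply: near_a_inj => //.
by rewrite near_eq (near_a_child epu) // dp.
Qed.

Lemma edge_coord w u :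
  e w u = hat_adj m (d v w) (side w) (d v u) (side u)
       || hat_adj m (d v u) (side u) (d v w) (side w).
Proof.
rewrite /hat_adj; have [uw|uw] := eqVneq (d v u) (d v w).+1.
  rewrite edge_up // [d v w == (d v u).+1](_ : _ = false) ?orbF //.
  by rewrite uw ltn_eqF.
have [wu|wu] := eqVneq (d v w) (d v u).+1; first by rewrite e_sym edge_up.
by apply/negbTE/negP => /(dist_edge v)[] /eqP; rewrite ?(negbTE uw) ?(negbTE wu).
Qed.

Lemma hat_pos_iso : graph_iso e (@hatted_cycle m.*2.+1).
Proof.
pose f w : 'I_m.*2.+1 := inord (hat_pos m (d v w) (side w)).
have fE w : f w = hat_pos m (d v w) (side w) :> nat.
  by rewrite inordK // hat_pos_lt ?dist_le_half ?side_valid.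
exists f; split; last first.
  move=> w u; rewrite edge_coord.
  by apply: hat_pos_adj; rewrite ?dist_le_half ?side_valid ?fE.
apply: inj_card_bij; last by rewrite card_ord -card_odd.
move=> w u fwu; have [] := @hat_pos_inj m m_gt1 (d v w) (side w) (d v u) (side u).
- exact: dist_le_half.
- exact: dist_le_half.
- exact: side_valid.
- exact: side_valid.
- by rewrite -!fE fwu.
exact: coord_inj.
Qed.

End Coordinates.

Lemma top_hatted : graph_iso e (@hatted_cycle m.*2.+1).
Proof.
have [a [_ [_ eva _]]] := two_neighbours v.
have /card_gt0P[x] : 0 < #|level v m| by rewrite top_card_level // leqnn andbT ltnW.
by rewrite inE => /eqP; apply: hat_pos_iso eva.
Qed.

End Top.

(** * The upper bound and its equality case *)

Lemma hatted_top : graph_iso e (@hatted_cycle m.*2.+1) -> exists v, tr v == m * m.+1.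
Proof.
case=> f [[g fK gK] fe].
pose v := g (inord m.+1).
have fv : f v = m.+1 :> nat by rewrite gK inordK //; move: m_gt1; clear; lia.
(* A lower bound on distances suffices: it gives [tr v] at least m (m + 1), and [tr_max] gives the
   converse. *)
have le_dist w : hat_dist m (f w) <= d v w.
  have [k dk] : exists k, d v w = k by exists (d v w).
  rewrite dk; elim: k w dk => [|k IH] w dk.
    move/eqP: dk; rewrite dist_eq0 => /eqP <-; rewrite fv /hat_dist subnn addn0.
    by case: (_ =P m.*2) => //; move: m_gt1; clear; lia.
  have [u euw du] := dist_pred dk.
  have hat_uw : hatted_cycle (f u) (f w) by rewrite fe.
  by apply: leq_trans (hat_dist_step m_gt1 hat_uw) _; rewrite ltnS IH.
exists v; rewrite eqn_leq tr_max -(sum_hat_dist m_gt1) transmissionE.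
rewrite (reindex f) /=; last by exists g => ? _.
exact: leq_sum.
Qed.

Lemma sum_tr_upper :
  \sum_w tr w <= 2 * (m ^ 3 + m ^ 2 + 2) ?= iff [exists v, tr v == m * m.+1].
Proof.
suff [le|[v /eqP topv]] : \sum_w tr w < 2 * (m ^ 3 + m ^ 2 + 2) \/ exists v, tr v == m * m.+1.
- split; [exact: ltnW | rewrite ltn_eqF //; apply/esym/negbTE/existsPn => v].
  by apply: contraTneq le => /top_sum_tr ->; rewrite ltnn.
- rewrite (top_sum_tr topv); split=> //; rewrite eqxx; apply/esym/existsP.
  by exists v; rewrite topv.
have /card_gt0P[u _] := T_gt0.
have [v v_max] : exists v, forall w, tr w <= tr v.
  by case: (arg_maxnP (i0 := u) (P := xpredT) tr) => // v _ max; exists v => w; apply: max.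
have sum_le : \sum_w tr w <= #|T| * tr v.
  by rewrite -sum_nat_const; apply: leq_sum.
(* Here the doubled bound exceeds (2m + 1)(m^2 + 1) by (m - 1)^2 + 2. *)
have [lt|lt] := leqP (tr v) (m ^ 2 + 1).
  left; apply: leq_ltn_trans sum_le _; have := card_odd; move: lt m_gt1; clear.
  by move: #|T| m (tr v) => n k M le k1 ->; nia.
pose r := tr v - (m ^ 2 + 1).
have trE : tr v = m ^ 2 + 1 + r by rewrite /r; move: lt; clear; lia.
have r0 : 0 < r by move: trE lt; clear; lia.
have rm : r < m by have := tr_max v; rewrite trE; clear; nia.
(* A gap at some k <= r would give [tr v] at most m^2 + k by [tr_gap], less than m^2 + 1 + r. *)
have tight k : k <= r -> tail v k = m.*2 - k.*2.
  move=> kr; apply/eqP; rewrite eqn_leq tail_le leqNgt; apply/negP => gap.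
  by have := tr_gap (leq_ltn_trans kr rm) gap; rewrite trE; move: kr; clear; lia.
have bound := sum_tr_bound rm tight v_max.
have [rE|r_ne] := eqVneq r m.-1.
  by right; exists v; rewrite trE rE; move: m_gt1; clear; case: m => // k _; apply/eqP; nia.
have [r1|r_ne1] := eqVneq r 1; last first.
  left; move: bound; rewrite trE; have := card_odd; move: r0 rm r_ne r_ne1; clear.
  move: (\sum_w _); move: #|T| m => n k S r0 rk rk1 r1 ->.
  (* With k standing for m, this is (r - 1)(k - 1 - r) > 0, true since 1 < r < k - 1. *)
  have key : k + r * r < r * k + 1 by nia.
  by move: key; clear; rewrite !expnS expn0; lia.
left; have m_gt2 : 2 < m by move: r_ne rm m_gt1; rewrite r1; clear; lia.
have [x [y [xy evx evy]]] := two_neighbours v.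
have lt_nbr z : e v z -> tr z < tr v.
  by move=> evz; have := v_max z; case: (tr_step evz); clear; lia.
(* Two neighbours of [v] lose 1 each, and (2m + 1)(m^2 + 2) - 2 is below the doubled bound by (m -
   2)^2 > 0. *)
have : \sum_w tr w + 2 <= #|T| * tr v.
  rewrite -sum_nat_const (bigD1 x) //= (bigD1 y) 1?eq_sym //=.
  rewrite [X in _ <= X](bigD1 x) //= [X in _ <= _ + X](bigD1 y) 1?eq_sym //=.
  have : \sum_(i | (i != x) && (i != y)) tr i <= \sum_(i | (i != x) && (i != y)) tr v.
    by apply: leq_sum.
  have := lt_nbr x evx; have := lt_nbr y evy; clear; lia.
rewrite trE r1; have := card_odd; move: m_gt2; clear.
by move: (\sum_w _) #|T| m => S n k k2 ->; nia.
Qed.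

End Graph.

(** * The bounds over the rationals *)

Local Open Scope ring_scope.

Theorem theorem3p3 (T : finType) (e : rel T) (n : nat)
    (Hsimple : simple_graph e) (Hsti : STI e) (Hn : #|T| = n) :
  let W : rat := (wiener e)%:R in
  let lower : rat := (3 * n%:R ^+ 2 - 4 * n%:R + 1) / 4 in
  let upper : rat := (n%:R ^+ 3 - n%:R ^+ 2 - n%:R + 17) / 8 in
  [/\ lower <= W <= upper,
      W = lower <-> graph_iso e (@complete_bipartite n.-1./2 n.+1./2) &
      (5 <= n)%N -> (W = upper <-> graph_iso e (@hatted_cycle n))].
Proof.
case: Hsimple Hsti => e_sym e_irr [[T_gt0 e_conn] sti] W lower upper.
have tr_step u v : e u v -> transmission e u = (transmission e v).+1 \/
    transmission e v = (transmission e u).+1 by move/sti; lia.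
have cardT := card_odd e_sym e_conn T_gt0 tr_step.
have two_W := wiener_transmission e_sym e_conn.
move: cardT; set m := (#|T|./2)%N => cardT.
have nE : n = m.*2.+1 by rewrite -Hn.
have nR : n%:R = 2 * m%:R + 1 :> rat by rewrite nE -addn1 natrD -mul2n natrM.
(* For n = 2m + 1 both bounds are natural numbers, so the claims become claims about the sum of
   transmissions, which is twice the Wiener index. *)
have lowerE : lower = (3 * m ^ 2 + m)%N%:R.
  by rewrite /lower nR natrD natrM natrX; field.
have upperE : upper = (m ^ 3 + m ^ 2 + 2)%N%:R.
  by rewrite /upper nR !natrD !natrX; field.
have W_eq k : W = k%:R <-> \sum_u transmission e u = (2 * k)%N.
  rewrite -two_W -mul2n; split=> [/eqP|/eqP]; first by rewrite eqr_nat => /eqP ->.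
  by rewrite eqn_pmul2l // /W => /eqP ->.
have le_double a b : (a <= b)%N = (2 * a <= 2 * b)%N by rewrite leq_pmul2l.
rewrite lowerE upperE !ler_nat (le_double _ (wiener e)) (le_double (wiener e)).
rewrite [(2 * wiener e)%N]mul2n two_W.
split.
- rewrite (sum_tr_lower e_sym e_conn T_gt0 tr_step) /=.
  have [m1|m1] := leqP m 1; first exact: (sum_tr_upper_small e_sym e_conn T_gt0 tr_step).
  exact: (sum_tr_upper e_sym e_conn T_gt0 e_irr tr_step m1).
- have -> : n.-1./2 = m by rewrite nE; lia.
  have -> : n.+1./2 = m.+1 by rewrite nE; lia.
  rewrite W_eq (sum_tr_lower_eq e_sym e_conn T_gt0 e_irr tr_step).
  exact: (balanced_bip_iso e_sym e_conn T_gt0 tr_step).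
rewrite nE => n5; have m1 : (1 < m)%N by lia.
rewrite W_eq; have [_ upper_eq] := sum_tr_upper e_sym e_conn T_gt0 e_irr tr_step m1.
split=> [/eqP|/(hatted_top e_sym e_conn T_gt0 e_irr tr_step m1)/existsP].
  rewrite upper_eq => /existsP[v /eqP].
  exact: (top_hatted e_sym e_conn T_gt0 e_irr tr_step m1).
by rewrite -upper_eq => /eqP.
Qed.
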